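(* Let $[Z]$ be a cloud with a nontrivial stabilizer whose center is $Z$. Suppose there exist spaces $Y_1,Y_2\in[Z]$ and a real number $r$ such that (1) $\max\{|Y_1,Z|,|Y_2,Z|\}=r>0$, and (2) $|Y_1,Y_2|>r$. Then the Gromov--Hausdorff distance between the clouds $[\Delta_1]$ and $[Z]$ is infinite.
   Context: All metric spaces are non-empty. $|X,Y|$ denotes the Gromov--Hausdorff distance between metric spaces $X,Y$ (possibly $\infty$). $\mathcal{GH}_0$ is the class of all metric spaces, where two spaces are identified if their Gromov--Hausdorff distance is zero. The equivalence classes of the relation $X\sim Y\Leftrightarrow |X,Y|<\infty$ on $\mathcal{GH}_0$ are called clouds; $[X]$ is the cloud containing $X$. $\Delta_1$ is the one-point metric space, so $[\Delta_1]$ is the cloud of all bounded metric spaces. For a real $\lambda>0$, $\lambda X$ is the space $X$ with all distances multiplied by $\lambda$. The stabilizer of a cloud $[X]$ is the multiplicative subgroup $\operatorname{St}([X])=\{\lambda>0:[\lambda X]=[X]\}$ of the positive reals; it is trivial if it equals $\{1\}$, and nontrivial otherwise. The center of a cloud with nontrivial stabilizer is the (known to exist and be unique) element $Z$ of the cloud, in $\mathcal{GH}_0$, such that $\lambda Z=Z$ in $\mathcal{GH}_0$ (i.e. $|\lambda Z,Z|=0$) for every $\lambda$ in the stabilizer. A correspondence $R$ between clouds $[X]$ and $[Y]$ is a surjective multivalued mapping from $[X]$ to $[Y]$, identified with its graph: a relation between elements of $[X]$ and elements of $[Y]$ such that every element of $[X]$ is related to at least one element of $[Y]$ and every element of $[Y]$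 is related to at least one element of $[X]$. The distortion is $\operatorname{dis}R=\sup\{\,\big||A,A'|-|B,B'|\big|:(A,B),(A',B')\in R\}$. The Gromov--Hausdorff distance between clouds is $d_{GH}([X],[Y])=\frac12\inf\{\operatorname{dis}R\}\in[0,\infty]$, the infimum over all correspondences $R$ between $[X]$ and $[Y]$. *)

(* Defs.v *)
From HB Require Import structures.
From mathcomp Require Import all_boot all_order all_algebra.
From mathcomp Require Import all_classical all_reals all_analysis.

Set Implicit Arguments.
Unset Strict Implicit.
Unset Printing Implicit Defensive.

Import Order.TTheory GRing.Theory Num.Theory.

Local Open Scope classical_set_scope.
Local Open Scope ring_scope.

(* [metricType R] allows an empty carrier. *)
Record mspace (R : realType) := MSpace {
  mspace_sort :> metricType R;
  mspace_inhabited : inhabited mspace_sort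
}.

Definition one_point : Type := unit.
HB.instance Definition _ := Choice.on one_point.

Section one_point.
Context (R : realType).
Let d (x y : one_point) : R := 0.

Let dxx x : d x x = 0. Proof. by []. Qed.

Let d_pos x y : d x y = 0 -> x = y. Proof. by case: x; case: y. Qed.

Let d_sym x y : d x y = d y x. Proof. by []. Qed.

Let d_triangle y x z : d x z <= d x y + d y z.
Proof. by rewrite /d addr0. Qed.

HB.instance Definition _ :=
  @isMetric.Build R one_point d dxx d_pos d_sym d_triangle.
End one_point.

Definition Delta1 (R : realType) : mspace R :=
  @MSpace R (one_point : metricType R) (inhabits tt).

Definition scaled (R : realType) (l : {posnum R}) (X : metricType R) : Type := X.
HB.instance Definition _ (R : realType) (l : {posnum R}) (X : metricType R) :=
  Choice.copy (scaled l X) X.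

Section scaled.
Context (R : realType) (l : {posnum R}) (X : metricType R).
Let d (x y : scaled l X) : R := l%:num * mdist (x : X) (y : X).

Let dxx x : d x x = 0. Proof. by rewrite /d mdistxx mulr0. Qed.

Let d_pos x y : d x y = 0 -> x = y.
Proof.
by move=> /eqP; rewrite mulf_eq0 gt_eqF//= => /eqP /mdist_positivity.
Qed.

Let d_sym x y : d x y = d y x. Proof. by rewrite /d metric_sym. Qed.

Let d_triangle y x z : d x z <= d x y + d y z.
Proof. by rewrite /d -mulrDr ler_pM2l// metric_triangle. Qed.

HB.instance Definition _ :=
  @isMetric.Build R (scaled l X) d dxx d_pos d_sym d_triangle.
End scaled.

Definition scale (R : realType) (l : {posnum R}) (X : mspace R) : mspace R :=
  @MSpace R (scaled l X : metricType R) (mspace_inhabited X).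

Definition hausdorff_dist (R : realType) (W : metricType R) (A B : set W) : \bar R :=
  ereal_inf [set r%:E | r in
    [set r : R | [/\ 0 < r,
      forall a, A a -> exists2 b, B b & mdist a b < r &
      forall b, B b -> exists2 a, A a & mdist b a < r]]].

Definition isometric_embedding (R : realType) (X W : metricType R) (f : X -> W) :=
  forall x y, mdist (f x) (f y) = mdist x y.

Definition GH_dist (R : realType) (X Y : mspace R) : \bar R :=
  ereal_inf [set h | exists (W : metricType R) (f : X -> W) (g : Y -> W),
    [/\ isometric_embedding f, isometric_embedding g &
        h = hausdorff_dist (range f) (range g)]].

(* Collections of spaces are predicates rather than [set (mspace R)]: the
   universe of [mspace R] is above the one over which [set] ranges. *)
Definition cloud (R : realType) (X : mspace R) : mspace R -> Prop :=
  fun Y => (GH_dist X Y < +oo)%E.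

Definition stabilizer (R : realType) (X : mspace R) : set {posnum R} :=
  [set l | cloud (scale l X) = cloud X].

Definition nontrivial_stabilizer (R : realType) (X : mspace R) : Prop :=
  stabilizer X <> [set 1%:pos].

Definition is_center (R : realType) (X Z : mspace R) : Prop :=
  cloud X Z /\ forall l, stabilizer X l -> GH_dist (scale l Z) Z = 0%E.

(* Points of a cloud are metric spaces up to Gromov--Hausdorff distance zero.
   They are handled through representatives, so a relation between points is a
   relation between spaces that is invariant under that identification (last
   clause). *)
Definition correspondence (R : realType) (C D : mspace R -> Prop)
    (r : mspace R -> mspace R -> Prop) : Prop :=
  [/\ forall A B, r A B -> C A /\ D B,
      forall A, C A -> exists B, r A B,
      forall B, D B -> exists A, r A B &
      forall A A' B B', GH_dist A A' = 0%E -> GH_dist B B' = 0%E ->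
        r A B -> r A' B'].

(* Both distances below are finite when [r] is a correspondence between clouds,
   so the subtraction never meets [+oo - +oo]. *)
Definition distortion (R : realType) (r : mspace R -> mspace R -> Prop) : \bar R :=
  ereal_sup [set t | exists A A' B B',
    [/\ r A B, r A' B' & t = `|GH_dist A A' - GH_dist B B'|%E]].

Definition cloud_dist (R : realType) (C D : mspace R -> Prop) : \bar R :=
  ((2^-1)%:E * ereal_inf [set t | exists2 r, correspondence C D r & t = distortion r])%E.

(* Main.v *)
From HB Require Import structures.
Require Import Defs.
From mathcomp Require Import all_boot all_order all_algebra.
From mathcomp Require Import all_classical all_reals all_analysis.
From mathcomp Require Import lra.

(** In the cloud of bounded spaces [2 |A, Delta1|] is the diameter of [A], so
    [|A, A'| <= max (|A, Delta1|, |A', Delta1|)]: two points at distance at most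
    [s] from [Delta1] are never further than [s] apart.  A correspondence of
    finite distortion transfers this, up to a bounded error, to the distances to
    [Z] in the other cloud.  But the center is fixed by arbitrarily large
    dilations [l] (powers of a nontrivial element of the stabilizer), and
    [l Y1], [l Y2] lie within [l r] of [Z] at a distance exceeding [l r] by
    a quantity proportional to [l]. *)

Set Implicit Arguments.
Unset Strict Implicit.
Unset Printing Implicit Defensive.

Import Order.TTheory GRing.Theory Num.Theory.

Local Open Scope classical_set_scope.
Local Open Scope ring_scope.

(** * Correspondences between metric spaces and the gluings they define *)

Definition rel_total (X Y : Type) (T : X -> Y -> Prop) : Prop :=
  (forall x, exists y, T x y) /\ (forall y, exists x, T x y).

(** The factor 2 absorbs the one half in the formula of the Gromov--Hausdorff distance by
    distortions, so that [s] compares directly with [GH_dist]. *)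
Definition rel_distortion_le (R : realType) (X Y : metricType R)
    (T : X -> Y -> Prop) (s : R) : Prop :=
  forall x y x' y', T x y -> T x' y' -> `|mdist x x' - mdist y y'| <= 2 * s.

Definition GH_rel (R : realType) (X Y : metricType R) (s : R) : Prop :=
  exists2 T : X -> Y -> Prop, rel_total T & rel_distortion_le T s.

(* The disjoint union of [X] and [Y] in which [T]-related points are put at
   distance [s]; positivity of [s] makes it a genuine metric space. *)
Definition glued (R : realType) (X Y : mspace R) (s : R) (T : X -> Y -> Prop)
    (s_gt0 : 0 < s) (T_total : rel_total T) (T_dis : rel_distortion_le T s) :
  Type := (X + Y)%type.
HB.instance Definition _ (R : realType) (X Y : mspace R) (s : R)
    (T : X -> Y -> Prop) (s_gt0 : 0 < s) (T_total : rel_total T)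
    (T_dis : rel_distortion_le T s) :=
  Choice.copy (glued s_gt0 T_total T_dis) (X + Y)%type.

Section glued_metric.
Context (R : realType) (X Y : mspace R) (s : R) (T : X -> Y -> Prop).
Hypotheses (s_gt0 : 0 < s) (T_total : rel_total T).
Hypothesis T_dis : rel_distortion_le T s.

(** Lengths of the paths that change space exactly once, jumping along a [T]-related pair at cost
    [s]. *)
Definition bridge_lengths (x : X) (y : Y) : set R :=
  [set t | exists x' y', T x' y' /\ t = mdist x x' + s + mdist y y'].

Definition bridge (x : X) (y : Y) : R := inf (bridge_lengths x y).

Lemma bridge_le x y x' y' :
  T x' y' -> bridge x y <= mdist x x' + s + mdist y y'.
Proof.
move=> Txy; apply: ge_inf; last by exists x', y'.
exists 0 => _ [u [v [_ ->]]].
by rewrite !addr_ge0 ?mdist_ge0 ?ltW.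
Qed.

Lemma le_bridge x y t :
  (forall x' y', T x' y' -> t <= mdist x x' + s + mdist y y') ->
  t <= bridge x y.
Proof.
move=> tle; apply: lb_le_inf.
  by have [y' Txy] := T_total.1 x; exists (mdist x x + s + mdist y y'), x, y'.
by move=> _ [x' [y' [Txy ->]]]; exact: tle.
Qed.

Lemma bridge_ge x y : s <= bridge x y.
Proof.
apply: le_bridge => x' y' _.
by have := mdist_ge0 x x'; have := mdist_ge0 y y'; lra.
Qed.

Let d (p q : glued s_gt0 T_total T_dis) : R :=
  match p, q with
  | inl x, inl x' => mdist x x'
  | inl x, inr y => bridge x y
  | inr y, inl x => bridge x y
  | inr y, inr y' => mdist y y'
  end.

Let dxx p : d p p = 0. Proof. by case: p => ?; rewrite /d mdistxx. Qed.

Let d_pos p q : d p q = 0 -> p = q.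
Proof.
case: p q => [x|y] [x'|y']; rewrite /d /=.
- by move=> /mdist_positivity ->.
- by have := bridge_ge x y'; move=> + E; rewrite E leNgt s_gt0.
- by have := bridge_ge x' y; move=> + E; rewrite E leNgt s_gt0.
- by move=> /mdist_positivity ->.
Qed.

Let d_sym p q : d p q = d q p.
Proof. by case: p q => [x|y] [x'|y']; rewrite /d // metric_sym. Qed.

Lemma bridge_trianglel x x' y : bridge x y <= mdist x x' + bridge x' y.
Proof.
rewrite -lerBlDl; apply: le_bridge => u v Tuv.
by have := bridge_le x y Tuv; have := metric_triangle x x' u; lra.
Qed.

Lemma bridge_triangler x y y' : bridge x y <= bridge x y' + mdist y' y.
Proof.
rewrite -lerBlDr; apply: le_bridge => u v Tuv.
have := bridge_le x y Tuv; have := metric_triangle y y' v.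
by rewrite (metric_sym y y'); lra.
Qed.

(** Going over through [(u, v)] and back through [(u', v')] costs two jumps, that is [2 * s], which
    is exactly what [T_dis] allows [mdist u u'] to exceed [mdist v v'] by. *)
Lemma mdist_le_bridgel x x' y : mdist x x' <= bridge x y + bridge x' y.
Proof.
rewrite -lerBlDr; apply: le_bridge => u v Tuv.
rewrite lerBlDr -lerBlDl; apply: le_bridge => u' v' Tuv'.
have := T_dis Tuv Tuv'; rewrite ler_norml => /andP[_].
have := metric_triangle x u x'; have := metric_triangle u u' x'.
have := metric_triangle v y v'; rewrite (metric_sym v y) (metric_sym u' x').
by lra.
Qed.

Lemma mdist_le_bridger x y y' : mdist y y' <= bridge x y + bridge x y'.
Proof.
rewrite -lerBlDr; apply: le_bridge => u v Tuv.
rewrite lerBlDr -lerBlDl; apply: le_bridge => u' v' Tuv'.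
have := T_dis Tuv Tuv'; rewrite ler_norml => /andP[+ _].
have := metric_triangle y v y'; have := metric_triangle v v' y'.
have := metric_triangle u x u'; rewrite (metric_sym u x) (metric_sym v' y').
by lra.
Qed.

Let d_triangle q p t : d p t <= d p q + d q t.
Proof.
case: p q t => [x1|y1] [x2|y2] [x3|y3]; rewrite /d /=.
- exact: metric_triangle.
- exact: bridge_trianglel.
- exact: mdist_le_bridgel.
- exact: bridge_triangler.
- by rewrite addrC metric_sym; exact: bridge_trianglel.
- exact: mdist_le_bridger.
- by rewrite addrC metric_sym; exact: bridge_triangler.
- exact: metric_triangle.
Qed.

HB.instance Definition _ :=
  @isMetric.Build R (glued s_gt0 T_total T_dis) d dxx d_pos d_sym d_triangle.

Lemma GH_dist_glued : (GH_dist X Y <= s%:E)%E.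
Proof.
pose W : metricType R := glued s_gt0 T_total T_dis.
have TE x y : T x y -> bridge x y <= s.
  by move=> /(bridge_le x y); rewrite !mdistxx add0r addr0.
apply: (@le_trans _ _ (hausdorff_dist (range (inl : X -> W)) (range (inr : Y -> W)))).
  by apply: ereal_inf_lbound; exists W, (inl : X -> W), (inr : Y -> W).
(* [hausdorff_dist] asks for strict inequalities, while related points are only known to be within
   [s]; hence the slack [e]. *)
apply/lee_addgt0Pr => e e_gt0; apply: ereal_inf_lbound.
exists (s + e) => //; split; first by rewrite addr_gt0.
- move=> _ [x _ <-]; have [y Txy] := T_total.1 x.
  exists (inr y); first by exists y.
  by rewrite (le_lt_trans (TE _ _ Txy)) // ltrDl.
- move=> _ [y _ <-]; have [x Txy] := T_total.2 y.
  exists (inl x); first by exists x.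
  by rewrite (le_lt_trans (TE _ _ Txy)) // ltrDl.
Qed.

End glued_metric.

(** * The Gromov--Hausdorff distance through correspondences *)

Section GH_dist_theory.
Context (R : realType).
Implicit Types (X Y Z W : mspace R) (s t : R) (l m : {posnum R}).

Lemma GH_rel_le X Y s : 0 < s -> GH_rel X Y s -> (GH_dist X Y <= s%:E)%E.
Proof. by move=> s_gt0 [T tot dis]; exact: (GH_dist_glued s_gt0 tot dis). Qed.

(** In a common ambient space where the images are Hausdorff-close, relate the points less than [s]
    apart; replacing both ends of a segment changes its length by at most [2 * s]. *)
Lemma GH_dist_lt_rel X Y s : (GH_dist X Y < s%:E)%E -> GH_rel X Y s.
Proof.
move=> /ereal_inf_lt [_ [W [f [g [fi gi ->]]]]].
move=> /ereal_inf_lt [_ [t [t_gt0 fg gf] <-]]; rewrite lte_fin => t_lt.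
exists (fun x y => mdist (f x) (g y) < s).
- split=> [x|y].
    have [|_ [y _ <-] xy] := fg (f x); first by exists x.
    by exists y; exact: lt_trans t_lt.
  have [|_ [x _ <-] xy] := gf (g y); first by exists y.
  by exists x; rewrite metric_sym; exact: lt_trans t_lt.
- move=> x y x' y' xy xy'; rewrite -fi -gi ler_norml.
  have := metric_triangle (f x) (g y) (f x').
  have := metric_triangle (g y) (g y') (f x').
  have := metric_triangle (g y) (f x) (g y').
  have := metric_triangle (f x) (f x') (g y').
  by rewrite (metric_sym (g y) (f x)) (metric_sym (g y') (f x')); lra.
Qed.

Lemma GH_dist_ge0 X Y : (0 <= GH_dist X Y)%E.
Proof.
apply: le_ereal_inf_tmp => _ [W [f [g [_ _ ->]]]].
by apply: le_ereal_inf_tmp => _ [t [/ltW t_ge0 _ _] <-].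
Qed.

Lemma GH_rel_ge0 X Y s : GH_rel X Y s -> 0 <= s.
Proof.
move=> [T [totl _] dis]; have [x] := mspace_inhabited X; have [y Txy] := totl x.
by have := le_trans (normr_ge0 _) (dis _ _ _ _ Txy Txy); lra.
Qed.

(** The infimum need not be attained, so only bounds [t] strictly above [s] yield a
    correspondence. *)
Lemma GH_dist_leP X Y s :
  (GH_dist X Y <= s%:E)%E <-> (forall t, s < t -> GH_rel X Y t).
Proof.
split=> [le_s t lt_t|rel].
  by apply: GH_dist_lt_rel; apply: le_lt_trans le_s _; rewrite lte_fin.
have s_ge0 : 0 <= s.
  rewrite leNgt; apply/negP => s_lt0.
  (* For negative [s], the number [s / 2] is above [s] but still negative, whereas a distortion
     bound cannot be. *)
  have /rel/GH_rel_ge0 : s < s / 2 by lra.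
  by lra.
apply/lee_addgt0Pr => e e_gt0; apply: GH_rel_le; first by rewrite ltr_wpDl.
by apply: rel; rewrite ltrDl.
Qed.

Lemma GH_rel_sym X Y s : GH_rel X Y s -> GH_rel Y X s.
Proof.
move=> [T [totl totr] dis]; exists (fun y x => T x y); first by split.
by move=> y x y' x' ? ?; rewrite distrC; exact: dis.
Qed.

Lemma GH_rel_trans X Y Z s t :
  GH_rel X Y s -> GH_rel Y Z t -> GH_rel X Z (s + t).
Proof.
move=> [S [Sl Sr] Sdis] [T [Tl Tr] Tdis].
exists (fun x z => exists2 y, S x y & T y z).
  split=> [x|z].
    by have [y Sxy] := Sl x; have [z Tyz] := Tl y; exists z, y.
  by have [y Tyz] := Tr z; have [x Sxy] := Sr y; exists x, y.
move=> x z x' z' [y Sxy Tyz] [y' Sxy' Tyz'].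
have := Sdis _ _ _ _ Sxy Sxy'; have := Tdis _ _ _ _ Tyz Tyz'.
by rewrite !ler_norml; lra.
Qed.

(** A space and its dilation share their carrier, so the same relation [T] serves on both sides. *)
Lemma GH_rel_scale l X Y s :
  GH_rel (scale l X) (scale l Y) (l%:num * s) <-> GH_rel X Y s.
Proof.
have eq (x x' : X) (y y' : Y) :
  (`|mdist (x : scale l X) x' - mdist (y : scale l Y) y'| <= 2 * (l%:num * s))
  = (`|mdist x x' - mdist y y'| <= 2 * s).
  rewrite [LHS](_ : _ = (`|l%:num * mdist x x' - l%:num * mdist y y'| <= 2 * (l%:num * s))) //.
  by rewrite -mulrBr normrM gtr0_norm // mulrCA ler_pM2l.
by split=> -[T tot dis]; exists T => // x y x' y' Txy Txy';
  [rewrite -eq|rewrite eq]; exact: dis.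
Qed.

Lemma GH_dist_sym X Y : GH_dist X Y = GH_dist Y X.
Proof.
suff le (A B : mspace R) : (GH_dist A B <= GH_dist B A)%E by apply/le_anti; rewrite !le.
case E : (GH_dist B A) => [s| |]; rewrite ?leey //; last first.
  by have := GH_dist_ge0 B A; rewrite E.
apply/GH_dist_leP => t st; apply: GH_rel_sym.
by move: t st; apply/GH_dist_leP; rewrite E.
Qed.

Lemma GH_dist_le_trans X Y Z s t : (GH_dist X Y <= s%:E)%E ->
  (GH_dist Y Z <= t%:E)%E -> (GH_dist X Z <= (s + t)%:E)%E.
Proof.
move=> /GH_dist_leP XY /GH_dist_leP YZ; apply/GH_dist_leP => u u_gt.
pose e := (u - (s + t)) / 2.
rewrite (_ : u = (s + e) + (t + e)); last by rewrite /e; lra.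
by apply: GH_rel_trans; [apply: XY|apply: YZ]; rewrite /e; lra.
Qed.

Lemma GH_dist_scale_le l X Y s :
  (GH_dist (scale l X) (scale l Y) <= (l%:num * s)%:E)%E
  <-> (GH_dist X Y <= s%:E)%E.
Proof.
rewrite !GH_dist_leP; split=> H t lt_t.
  by apply/(GH_rel_scale l)/H; rewrite ltr_pM2l.
rewrite (_ : t = l%:num * (t / l%:num)); last by rewrite mulrC divfK.
by apply/GH_rel_scale/H; rewrite ltr_pdivlMr // mulrC.
Qed.

Lemma GH_dist_eq0 X Y : (GH_dist X Y <= 0)%E -> GH_dist X Y = 0%E.
Proof. by move=> le0; apply/le_anti; rewrite le0 GH_dist_ge0. Qed.

(** The graph of [f] has distortion zero, and [g] makes it surjective. *)
Lemma isometry_GH_dist0 X Y (f : X -> Y) (g : Y -> X) :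
  cancel g f -> isometric_embedding f -> GH_dist X Y = 0%E.
Proof.
move=> gK fi; apply: GH_dist_eq0; apply/GH_dist_leP => t t_gt0.
exists (fun x y => f x = y); first by split=> [x|y]; [exists (f x)|exists (g y)].
by move=> x _ x' _ <- <-; rewrite fi subrr normr0; lra.
Qed.

Lemma GH_dist0_trans X Y Z :
  GH_dist X Y = 0%E -> GH_dist Y Z = 0%E -> GH_dist X Z = 0%E.
Proof.
move=> XY YZ; apply: GH_dist_eq0; rewrite -[0%E]/(0%:E) -[0 in X in (_ <= X)%E]addr0.
by apply: (@GH_dist_le_trans _ Y); rewrite ?XY ?YZ.
Qed.

Lemma GH_dist0_scale l X Y :
  GH_dist (scale l X) (scale l Y) = 0%E <-> GH_dist X Y = 0%E.
Proof.
have := GH_dist_scale_le l X Y 0; rewrite mulr0 => -[H1 H2].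
by split=> E; apply: GH_dist_eq0; [apply: H1|apply: H2]; rewrite E.
Qed.

Lemma GH_dist_scaleM l m X :
  GH_dist (scale (l%:num * m%:num)%:pos X) (scale l (scale m X)) = 0%E.
Proof.
apply: (@isometry_GH_dist0 (scale (l%:num * m%:num)%:pos X)
  (scale l (scale m X)) id id) => // x y.
exact: mulrA.
Qed.

Lemma GH_dist_scale1 X : GH_dist (scale 1%:pos X) X = 0%E.
Proof.
apply: (@isometry_GH_dist0 (scale 1%:pos X) X id id) => // x y.
exact/esym/mul1r.
Qed.

Lemma le_cloud X Y Z : (GH_dist X Y < +oo)%E -> cloud Y Z -> cloud X Z.
Proof.
rewrite /cloud; have := GH_dist_ge0 X Y; have := GH_dist_ge0 Y Z.
case XY : (GH_dist X Y) => [s| |] //; case YZ : (GH_dist Y Z) => [t| |] // _ _ _ _.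
apply: (@le_lt_trans _ _ (s + t)%:E); last exact: ltry.
by apply: (@GH_dist_le_trans _ Y); rewrite ?XY ?YZ.
Qed.

Lemma eq_cloud X Y : (GH_dist X Y < +oo)%E -> cloud X = cloud Y.
Proof.
move=> XY; apply/funext => Z; apply/propext; split; apply: le_cloud => //.
by rewrite GH_dist_sym.
Qed.

(* [GH_dist A Delta1] is half the diameter of [A]. *)
Lemma GH_dist_le_Delta1 X Y s : (GH_dist X (Delta1 R) <= s%:E)%E ->
  (GH_dist Y (Delta1 R) <= s%:E)%E -> (GH_dist X Y <= s%:E)%E.
Proof.
move=> X1 Y1; apply/GH_dist_leP => t st.
have diam (A : mspace R) : (GH_dist A (Delta1 R) <= s%:E)%E ->
    forall a a' : A, 0 <= mdist a a' <= 2 * t.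
  move=> /GH_dist_leP/(_ t st)[T [tot _] dis] a a'.
  have [b Tab] := tot a; have [b' Tab'] := tot a'.
  have := dis _ _ _ _ Tab Tab'; rewrite mdist_ge0 /=.
  have -> : b = b' by case: b b' {Tab Tab'} => -[].
  by rewrite mdistxx subr0 ger0_norm ?mdist_ge0.
(* The full relation suffices: both distances lie between 0 and [2 * t], hence so does their
   difference in absolute value. *)
exists (fun _ _ => True).
  by split=> _; [have [y] := mspace_inhabited Y; exists y
                |have [x] := mspace_inhabited X; exists x].
move=> x y x' y' _ _; have := diam _ X1 x x'; have := diam _ Y1 y y'.
by rewrite ler_norml; lra.
Qed.

(** * Large dilations that fix the center *)

Lemma nontrivial_center_scale Z : nontrivial_stabilizer Z -> is_center Z Z ->
  exists2 l : {posnum R}, 1 < l%:num & GH_dist (scale l Z) Z = 0%E.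
Proof.
move=> ntriv [_ cen].
have [l [l_stab l_neq1]] : exists l, stabilizer Z l /\ l <> 1%:pos.
  (* The stabilizer always contains 1, so being different from the singleton of 1 forces another
     element. *)
  apply/not_existsP => H; apply: ntriv; apply/seteqP; split=> l.
    by move=> l_stab; apply: contrapT => ?; apply: (H l).
  by move=> ->; apply: eq_cloud; rewrite GH_dist_scale1.
have {cen l_stab} lZ := cen _ l_stab.
case: (ltgtP 1 l%:num) => [l_gt1|l_lt1|l_eq1]; first by exists l.
(* If [l] contracts, its inverse expands, and it fixes [Z] as well: apply it to both sides of
   [lZ]. *)
- exists (l%:num^-1)%:pos; first by rewrite /= invf_gt1.
  apply: (@GH_dist0_trans _ (scale (l%:num^-1)%:pos (scale l Z))).
    by apply/GH_dist0_scale; rewrite GH_dist_sym.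
  rewrite GH_dist_sym; apply: GH_dist0_trans (GH_dist_scaleM _ _ _).
  rewrite GH_dist_sym (_ : (_%:pos) = 1%:pos) ?GH_dist_scale1 //.
  by apply: val_inj; rewrite /= mulVf.
- by case: l_neq1; apply: val_inj.
Qed.

(** Products of dilations fixing [Z] fix [Z], and by Bernoulli's inequality the powers of some [l]
    above 1 grow at least linearly. *)
Lemma center_unbounded_scale Z M : nontrivial_stabilizer Z -> is_center Z Z ->
  exists2 l : {posnum R}, M < l%:num & GH_dist (scale l Z) Z = 0%E.
Proof.
move=> ntriv cen; have [l l_gt1 lZ] := nontrivial_center_scale ntriv cen.
have powers n : exists2 m : {posnum R},
    1 + n%:R * (l%:num - 1) <= m%:num & GH_dist (scale m Z) Z = 0%E.
  elim: n => [|n [m m_ge mZ]].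
    by exists 1%:pos; rewrite ?GH_dist_scale1 //= mul0r addr0.
  exists (l%:num * m%:num)%:pos; last first.
    apply: GH_dist0_trans (GH_dist_scaleM _ _ _) _.
    by apply: GH_dist0_trans lZ; apply/GH_dist0_scale.
  have am : l%:num * (1 + n%:R * (l%:num - 1)) <= l%:num * m%:num.
    by rewrite ler_pM2l.
  (* This is the quadratic term discarded in the induction step of Bernoulli's inequality. *)
  have : 0 <= n%:R * ((l%:num - 1) * (l%:num - 1)) by rewrite mulr_ge0 ?sqr_ge0.
  by rewrite /= -natr1; lra.
pose n := Num.bound `|M / (l%:num - 1)|.
have [m m_ge mZ] := powers n; exists m => //; apply: lt_le_trans m_ge.
have l1_gt0 : 0 < l%:num - 1 by rewrite subr_gt0.
have : M / (l%:num - 1) < n%:R.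
  exact: le_lt_trans (ler_norm _) (archi_boundP (normr_ge0 _)).
by rewrite ltr_pdivrMr //; lra.
Qed.

End GH_dist_theory.

(** * Transfer of distances along a correspondence of finite distortion *)

(** Nonnegativity excludes [-oo], and the finite bound [D] excludes [+oo], even for both arguments
    at once: [+oo - +oo] is [-oo] by convention, of absolute value [+oo]. *)
Lemma le_abse_sub (R : realType) (x y : \bar R) (a D : R) :
  (0 <= x)%E -> (0 <= y)%E -> (`|x - y| <= D%:E)%E ->
  ((y <= a%:E)%E -> (x <= (a + D)%:E)%E) /\
  ((x <= a%:E)%E -> (y <= (a + D)%:E)%E).
Proof.
case: x => [x| |] //; case: y => [y| |] //= _ _.
by rewrite !lee_fin ler_norml; lra.
Qed.

Theorem theorem4 (R : realType) (Z : mspace R)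
    (Z_stab : nontrivial_stabilizer Z) (Z_center : is_center Z Z)
    (Y1 Y2 : mspace R) (Y1_cloud : cloud Z Y1) (Y2_cloud : cloud Z Y2)
    (r : R) (r_gt0 : 0 < r)
    (max_eq : maxe (GH_dist Y1 Z) (GH_dist Y2 Z) = r%:E)
    (dist_gt : (r%:E < GH_dist Y1 Y2)%E) :
  cloud_dist (cloud (Delta1 R)) (cloud Z) = +oo%E.
Proof.
(* The infimum of a set with no finite element is [+oo], also when that set is empty. *)
suff dis_oo rho : correspondence (cloud (Delta1 R)) (cloud Z) rho ->
    distortion rho = +oo%E.
  rewrite /cloud_dist (_ : ereal_inf _ = +oo%E) ?gt0_muley ?lte_fin ?invr_gt0 //.
  by apply/eqP; rewrite -leye_eq; apply: le_ereal_inf_tmp => _ [rho /dis_oo -> ->].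
move=> [rho_cloud _ rho_sur _]; apply: contrapT => /eqP dis_noo.
have [D rhoD] : exists D : R, forall A A' B B', rho A B -> rho A' B' ->
    (`|GH_dist A A' - GH_dist B B'| <= D%:E)%E.
  exists (fine (distortion rho)) => A A' B B' AB AB'.
  have : (`|GH_dist A A' - GH_dist B B'| <= distortion rho)%E.
    by apply: ereal_sup_ubound; exists A, A', B, B'.
  (* For the value [-oo], where [fine] defaults to 0, the bound at hand is even stronger than the
     one wanted. *)
  case: (distortion rho) dis_noo => [D| |] //= _ le_noo.
  exact: le_trans le_noo (leNye _).
(* The distance between [Y1] and [Y2] is replaced by a real number still above [r], so that the gap
   [r' - r] can be multiplied by [l]. *)
have [r' r'_gt r'_lt] : exists2 r' : R, r < r' & (r'%:E < GH_dist Y1 Y2)%E.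
  case: (GH_dist Y1 Y2) dist_gt => [d| |] //; last by exists (r + 1); rewrite ?ltry ?ltrDl.
  by rewrite lte_fin => rd; exists ((r + d) / 2); rewrite ?lte_fin; lra.
have Z_cloud : cloud Z Z by case: Z_center.
have [A0 A0Z] := rho_sur _ Z_cloud.
have [c A0c] : exists c : R, (GH_dist A0 (Delta1 R) <= c%:E)%E.
  have := (rho_cloud _ _ A0Z).1; rewrite /cloud GH_dist_sym.
  have := GH_dist_ge0 A0 (Delta1 R).
  by case: (GH_dist _ _) => [c| |] // _ _; exists c.
(* The threshold makes [l * (r' - r)] exceed all errors: [D] for passing to the bounded cloud, [c]
   for replacing [A0] by the one-point space, and [D] for coming back. *)
have [l l_gt lZ] := center_unbounded_scale ((2 * D + c) / (r' - r)) Z_stab Z_center.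
have scale_Z Y : (GH_dist Y Z <= r%:E)%E ->
    (GH_dist (scale l Y) Z <= (l%:num * r)%:E)%E.
  move=> YZ; rewrite -[l%:num * r]addr0; apply: (@GH_dist_le_trans _ _ (scale l Z)).
    exact/GH_dist_scale_le.
  by rewrite lZ.
have near Y : (GH_dist Y Z <= r%:E)%E -> exists2 A, rho A (scale l Y) &
    (GH_dist A (Delta1 R) <= (l%:num * r + D + c)%:E)%E.
  move=> /scale_Z YZ; have [|A AY] := rho_sur (scale l Y).
    by rewrite /cloud GH_dist_sym (le_lt_trans YZ) ?ltry.
  (* Triangle inequality through [A0], the partner of [Z]: the distortion bounds the distance from
     [A] to [A0] by [l * r + D]. *)
  exists A => //; apply: GH_dist_le_trans A0c.
  exact: (le_abse_sub _ (GH_dist_ge0 _ _) (GH_dist_ge0 _ _) (rhoD _ _ _ _ AY A0Z)).1.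
have [|A1 A1Y A1le] := near Y1; first by rewrite -max_eq le_max lexx.
have [|A2 A2Y A2le] := near Y2; first by rewrite -max_eq le_max lexx orbT.
have A12 := GH_dist_le_Delta1 A1le A2le.
have := (le_abse_sub _ (GH_dist_ge0 _ _) (GH_dist_ge0 _ _)
  (rhoD _ _ _ _ A1Y A2Y)).2 A12.
have lr' : l%:num * r + D + c + D <= l%:num * r'.
  by move: l_gt; rewrite ltr_pdivrMr ?subr_gt0 // mulrBr; lra.
rewrite -lee_fin in lr'.
(* Dividing by [l] puts [Y1] and [Y2] within [r'] of each other, against the choice of [r']. *)
by move=> /le_trans/(_ lr')/GH_dist_scale_le; rewrite leNgt r'_lt.
Qed.
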